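(* Let $g\ge 3$ be an integer. Then the class of line graphs of graphs of girth at least $g$ is not intersectionwise $\chi$-guarding. In particular, the class of line graphs is not intersectionwise $\chi$-guarding.
   Context: All graphs are finite and simple; classes are taken closed under isomorphism and induced subgraphs. The line graph $L(G)$ of $G$ has vertex set $E(G)$, two edges adjacent iff they share an endpoint. The girth of a graph is the length of its shortest cycle (infinite for forests). The graph-intersection of classes $\mathcal{A},\mathcal{B}$ is the class of all graphs $(V(G)\cap V(H),E(G)\cap E(H))$ with $G\in\mathcal{A}$, $H\in\mathcal{B}$. A class is $\chi$-bounded if there is a non-decreasing $f:\mathbb{N}\to\mathbb{N}$ with $\chi(G)\le f(\omega(G))$ for all members. A class $\mathcal{A}$ is intersectionwise $\chi$-guarding if for every $\chi$-bounded class $\mathcal{B}$ the graph-intersection of $\mathcal{A}$ and $\mathcal{B}$ is $\chi$-bounded. *)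

(* Defs.v *)
From mathcomp Require Import all_boot.

Set Implicit Arguments.
Unset Strict Implicit.
Unset Printing Implicit Defensive.

(* A finite simple graph (V, E), with V a subset of an ambient finite type T,
   so that graphs on the same T can be intersected literally.  Everything below
   is insensitive to the choice of T. *)
Record graph (T : finType) := Graph {
  vset : {set T};
  eset : {set {set T}};
  esetP : eset \subset [set e : {set T} | (e \subset vset) && (#|e| == 2)]
}.

Section Graph.
Variables (T : finType) (G : graph T).

Definition vertex := {x : T | x \in vset G}.

Definition adj : rel T := fun x y => [set x; y] \in eset G.

Definition clique (S : {set T}) : bool :=
  (S \subset vset G) && [forall x in S, forall y in S, (x != y) ==> adj x y].

Definition omega : nat := \max_(S : {set T} | clique S) #|S|.

Definition colorable (k : nat) : bool :=
  [exists c : {ffun vertex -> 'I_k},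
     [forall x, forall y, adj (val x) (val y) ==> (c x != c y)]].

Lemma adj_neq x y : adj x y -> x != y.
Proof.
move=> /(subsetP (esetP G)); rewrite inE => /andP[_].
by apply: contraL => /eqP->; rewrite setUid cards1.
Qed.

Lemma colorable_exists : exists k, colorable k.
Proof.
exists #|{: vertex}|; apply/existsP; exists [ffun x => enum_rank x].
apply/forallP=> x; apply/forallP=> y; apply/implyP=> /adj_neq.
by rewrite !ffunE (inj_eq enum_rank_inj).
Qed.

Definition chi : nat := ex_minn colorable_exists.

Definition is_cycle (s : seq T) : bool := (2 < size s) && ucycleb adj s.

(* [None] stands for infinite girth; no cycle is longer than #|T|. *)
Definition girth : option nat :=
  ohead [seq n <- iota 0 #|T|.+1 | [exists s : n.-tuple T, is_cycle s]].

Definition girth_at_least (g : nat) : bool :=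
  if girth is Some n then g <= n else true.

Lemma girth_at_leastP g :
  reflect (forall s, is_cycle s -> g <= size s) (girth_at_least g).
Proof.
rewrite /girth_at_least /girth.
set p := fun n => [exists s : n.-tuple T, is_cycle s].
have pP s : is_cycle s -> p (size s).
  by move=> cs; apply/existsP; exists (in_tuple s).
have ps s : is_cycle s -> size s \in [seq n <- iota 0 #|T|.+1 | p n].
  move=> cs; rewrite mem_filter pP // mem_iota /= add0n ltnS.
  by case/and3P: cs => _ _ /card_uniqP <-; apply: max_card.
have : sorted leq [seq n <- iota 0 #|T|.+1 | p n].
  by apply: sorted_filter (iota_sorted _ _); apply: leq_trans.
have pn n : n \in [seq n <- iota 0 #|T|.+1 | p n] -> p n.
  by rewrite mem_filter => /andP[].
case: [seq n <- _ | p n] ps pn => [|n r] /= ps pn.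
  by move=> _; apply: ReflectT => s /ps.
move=> /(order_path_min leq_trans) /allP nr; apply: (iffP idP) => [gn s /ps|h].
  by rewrite inE => /predU1P[->//|/nr]; apply: leq_trans gn.
have /existsP[s cs] := pn n (mem_head _ _).
by rewrite -(size_tuple s) h.
Qed.

Fact induced_subproof (S : {set T}) :
  [set e in eset G | e \subset S]
    \subset [set e : {set T} | (e \subset vset G :&: S) && (#|e| == 2)].
Proof.
apply/subsetP=> e; rewrite !inE => /andP[/(subsetP (esetP G))].
by rewrite inE subsetI => /andP[-> ->] ->.
Qed.

Definition induced (S : {set T}) : graph T := Graph (induced_subproof S).

Fact line_graph_subproof :
  [set [set e; f] | e in eset G, f in eset G & (e != f) && (e :&: f != set0)]
    \subset [set d : {set {set T}} | (d \subset eset G) && (#|d| == 2)].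
Proof.
apply/subsetP=> d /imset2P[e f eG]; rewrite inE => /and3P[fG nef _] ->.
by rewrite inE subUset !sub1set eG fG cards2 nef.
Qed.

Definition line_graph : graph {set T} := Graph line_graph_subproof.

End Graph.

Fact graph_inter_subproof (T : finType) (G H : graph T) :
  eset G :&: eset H
    \subset [set e : {set T} | (e \subset vset G :&: vset H) && (#|e| == 2)].
Proof.
apply/subsetP=> e /setIP[/(subsetP (esetP G)) + /(subsetP (esetP H))].
by rewrite !inE subsetI => /andP[-> ->] /andP[-> _].
Qed.

Definition graph_inter (T : finType) (G H : graph T) : graph T :=
  Graph (graph_inter_subproof G H).

Definition isomorphic (T U : finType) (G : graph T) (H : graph U) : Prop :=
  exists2 f : vertex G -> vertex H, bijective f &
    forall x y, adj H (val (f x)) (val (f y)) = adj G (val x) (val y).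

Definition graph_family := forall T : finType, graph T -> Prop.

Definition graph_class (A : graph_family) : Prop :=
  (forall (T U : finType) (G : graph T) (H : graph U),
     isomorphic G H -> A T G -> A U H) /\
  (forall (T : finType) (G : graph T) (S : {set T}),
     A T G -> A T (induced G S)).

Definition chi_bounded (A : graph_family) : Prop :=
  exists2 f : nat -> nat, {homo f : m n / m <= n} &
    forall (T : finType) (G : graph T), A T G -> chi G <= f (omega G).

Definition graph_intersection (A B : graph_family) : graph_family :=
  fun T K => exists (U : finType) (G H : graph U),
    [/\ A U G, B U H & isomorphic (graph_inter G H) K].

Definition intersectionwise_chi_guarding (A : graph_family) : Prop :=
  forall B : graph_family,
    graph_class B -> chi_bounded B -> chi_bounded (graph_intersection A B).

Definition line_graphs : graph_family :=
  fun T K => exists (U : finType) (G : graph U), isomorphic (line_graph G) K.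

Definition line_graphs_girth (g : nat) : graph_family :=
  fun T K => exists (U : finType) (G : graph U),
    girth_at_least G g /\ isomorphic (line_graph G) K.

Lemma isomorphic_trans (T U W : finType) (G : graph T) (H : graph U)
    (K : graph W) : isomorphic G H -> isomorphic H K -> isomorphic G K.
Proof.
move=> [f bf fE] [h bh hE]; exists (h \o f); first exact: bij_comp.
by move=> x y; rewrite hE fE.
Qed.

Lemma adj_line_graph (T : finType) (G : graph T) (e f : {set T}) :
  adj (line_graph G) e f =
    [&& e \in eset G, f \in eset G, e != f & e :&: f != set0].
Proof.
apply/idP/idP=> [ef|/and4P[eG fG nef ief]]; last first.
  by apply/imset2P; exists e f; rewrite // inE fG nef.
have nef := adj_neq ef; rewrite nef /=.
have [a b aG] := imset2P ef; rewrite inE => /and3P[bG _ iab] efab.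
have : e \in [set a; b] by rewrite -efab set21.
have : f \in [set a; b] by rewrite -efab set22.
rewrite !inE => /orP[]/eqP fE /orP[]/eqP eE; subst e f.
- by rewrite eqxx in nef.
- by rewrite bG aG setIC.
- by rewrite bG aG.
- by rewrite eqxx in nef.
Qed.

Lemma adj_induced (T : finType) (G : graph T) (S : {set T}) (x y : T) :
  x \in S -> y \in S -> adj (induced G S) x y = adj G x y.
Proof.
by move=> xS yS; rewrite /adj /= inE subUset !sub1set xS yS !andbT.
Qed.

(* Any induced subgraph of a copy of L(G) is a copy of L(G') for some
   spanning subgraph G' of G. *)
Lemma induced_line_graph (T U : finType) (G : graph U) (K : graph T)
    (S : {set T}) : isomorphic (line_graph G) K ->
  exists G' : graph U,
    eset G' \subset eset G /\ isomorphic (line_graph G') (induced K S).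
Proof.
move=> [f [h fK hK] fE].
pose E' := [set val x | x : vertex (line_graph G) & val (f x) \in S].
have sE' : E' \subset eset G by apply/subsetP=> _ /imsetP[x _ ->]; apply: valP x.
exists (Graph (subset_trans sE' (esetP G))); split=> //.
set G' := Graph _.
have inE' (e : vertex (line_graph G')) : val e \in vset (line_graph G).
  exact: (subsetP sE') (valP e).
pose up e : vertex (line_graph G) := Sub (val e) (inE' e).
have inS e : val (f (up e)) \in S.
  have /imsetP[x] := valP e; rewrite inE => xS ex.
  by have -> : up e = x by apply: val_inj.
have inKS e : val (f (up e)) \in vset (induced K S).
  by rewrite /= inE inS andbT; apply: valP (f _).
have inK (y : vertex (induced K S)) : val y \in vset K.
  by have /setIP[] := valP y.
pose uq y : vertex K := Sub (val y) (inK y).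
have inL y : val (h (uq y)) \in vset (line_graph G').
  apply/imsetP; exists (h (uq y)) => //; rewrite inE hK.
  by have /setIP[] := valP y.
exists (fun e => Sub (val (f (up e))) (inKS e)).
  exists (fun y => Sub (val (h (uq y))) (inL y)) => [e|y]; apply: val_inj => /=.
    by rewrite (_ : uq _ = f (up e)) ?fK //; apply: val_inj.
  by rewrite (_ : up _ = h (uq y)) ?hK //; apply: val_inj.
move=> x y; rewrite adj_induced ?inS //= fE /= !adj_line_graph.
by rewrite (valP x) (valP y) (inE' x) (inE' y).
Qed.

Lemma line_graphs_class : graph_class line_graphs.
Proof.
split=> [T W K K' KK' [U [G GK]]|T K S [U [G GK]]].
  by exists U, G; apply: isomorphic_trans GK KK'.
by have [G' [_ G'K]] := induced_line_graph S GK; exists U, G'.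
Qed.

Lemma line_graphs_girth_class g : graph_class (line_graphs_girth g).
Proof.
split=> [T W K K' KK' [U [G [gG GK]]]|T K S [U [G [/girth_at_leastP gG GK]]]].
  by exists U, G; split=> //; apply: isomorphic_trans GK KK'.
have [G' [/subsetP sG' G'K]] := induced_line_graph S GK; exists U, G'.
split=> //; apply/girth_at_leastP=> s /and3P[s2 cs us]; apply: gG.
rewrite /is_cycle s2 /ucycleb us andbT /=.
by apply: sub_cycle cs => x y; apply: sG'.
Qed.

(* Main.v *)
Require Import Defs.
From mathcomp Require Import all_boot.
From mathcomp Require Import zify.

(* Let G be a graph of large girth and large chromatic number on {0, ..., n-1},
   and let H be the graph on E(G) in which two edges are adjacent when, viewed
   as intervals, they overlap in at most an endpoint.  H is the comparability
   graph of an interval order, hence chi-bounded by Mirsky's theorem, while the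
   intersection of L(G) and H is a shift graph: it is triangle-free, and a
   q-colouring of it yields a 2^q-colouring of G.

   Graphs of large girth and chromatic number are obtained by a derandomised
   form of Erdos' argument: edges joining far apart vertices of small degree
   are added one at a time, each chosen so as to destroy a constant fraction of
   the large independent sets.  After linearly many steps none is left. *)

Set Implicit Arguments.
Unset Strict Implicit.
Unset Printing Implicit Defensive.

(** * Graphs of large girth and chromatic number *)

Section Greedy.
Variable T : finType.
Implicit Types (e : rel T) (u v x y : T) (p : seq T) (S : {set T}).

Definition deg e x := #|[set y | e x y]|.

Definition ball e l x : {set T} :=
  iter l (fun A => A :|: \bigcup_(y in A) [set z | e y z]) [set x].

Lemma card_ball e D l x :
  (forall y, deg e y <= D) -> #|ball e l x| <= D.+1 ^ l.
Proof.
move=> degD; elim: l => [|l IHl]; first by rewrite cards1.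
rewrite /ball iterS -/(ball e l x) expnSr.
apply: leq_trans (leq_mul IHl (leqnn _)).
set A := ball e l x; apply: leq_trans (leq_card_setU _ _) _.
rewrite mulnS leq_add2l -sum_nat_const.
suff : #|\bigcup_(y in A) [set z | e y z]| <= \sum_(y in A) deg e y.
  by move/leq_trans; apply; apply: leq_sum.
elim/big_rec2: _ => [|y m B _ IH]; first by rewrite cards0.
by apply: leq_trans (leq_card_setU _ _) _; rewrite leq_add2l.
Qed.

Lemma path_ball e l x p :
  path e x p -> size p <= l -> last x p \in ball e l x.
Proof.
elim: l p => [|l IHl] p; first by case: p => //= _ _; rewrite set11.
rewrite /ball iterS -/(ball e l x) inE.
case: (lastP p) => [_ _|{}p y]; first by rewrite (IHl [::]).
rewrite rcons_path size_rcons last_rcons => /andP[pp py] sp.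
by apply/orP; right; apply/bigcupP; exists (last x p); rewrite ?inE ?IHl.
Qed.

(** * Effect of a new edge on degrees, cycles and independent sets *)

Definition add_edge e u v : rel T :=
  fun x y => [|| e x y, (x == u) && (y == v) | (x == v) && (y == u)].

Lemma add_edge_sym e u v : symmetric e -> symmetric (add_edge e u v).
Proof.
move=> se x y; rewrite /add_edge se; congr (_ || _).
by rewrite orbC; congr (_ || _); rewrite andbC.
Qed.

Lemma add_edge_irr e u v :
  irreflexive e -> u != v -> irreflexive (add_edge e u v).
Proof.
move=> ie uv x; rewrite /add_edge ie /=.
by apply/negP=> /orP[]/andP[/eqP-> /eqP vu]; rewrite vu eqxx in uv.
Qed.

Lemma deg_add_edge e u v x :
  deg (add_edge e u v) x <= deg e x + ((x == u) + (x == v)).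
Proof.
have sub : [set y | add_edge e u v x y] \subset
    [set y | e x y] :|: ((if x == u then [set v] else set0)
                     :|: (if x == v then [set u] else set0)).
  apply/subsetP=> y; rewrite !inE /add_edge => /or3P[->//| |] /andP[->];
  by case: ifP => _; rewrite !inE => ->; rewrite ?orbT.
apply: leq_trans (subset_leq_card sub) _.
apply: leq_trans (leq_card_setU _ _) _; rewrite leq_add2l.
apply: leq_trans (leq_card_setU _ _) _.
by apply: leq_add; case: ifP; rewrite ?cards1 ?cards0.
Qed.

Lemma sum_deg_add_edge e u v :
  \sum_x deg (add_edge e u v) x <= (\sum_x deg e x) + 2.
Proof.
have /leq_trans -> // : \sum_x deg (add_edge e u v) x
    <= \sum_x (deg e x + ((x == u) + (x == v))).
  by apply: leq_sum => x _; apply: deg_add_edge.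
rewrite big_split leq_add2l big_split /=.
by rewrite -!big_mkcond !sum1_card /= ?card1.
Qed.

Definition cycles_ge e g :=
  forall s, 2 < size s -> ucycleb e s -> g <= size s.

(** A short new cycle would have to use the edge [uv], and the rest of it would be a path of [e] of
    length less than [g] between [u] and [v]. *)
Lemma cycles_ge_add_edge e u v g : symmetric e -> v \notin ball e g u ->
  cycles_ge e g -> cycles_ge (add_edge e u v) g.
Proof.
move=> se vu ge s s2 /andP[cs us]; rewrite leqNgt; apply/negP=> sg.
have [ces|] := boolP (cycle e s).
  by have := ge s s2; rewrite /ucycleb ces us leqNgt sg => /(_ isT).
apply/negP; rewrite negbK; apply: cycle_from_next => // x xs.
have [i s' sE] := rot_to xs.
rewrite -(next_rot i us).
move: cs us s2 sg; rewrite -(rot_cycle i) -(rot_uniq i) -(size_rot i s) sE.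
case: s' {sE} => [//|y [//|a q]] /=; rewrite eqxx => /and3P[exy eya eq].
move=> /and4P[xs' ys' _ _] _ sg.
apply/idPn => nexy.
have uvE : (x == u) && (y == v) || (x == v) && (y == u).
  by move: exy; rewrite /add_edge (negbTE nexy).
(* The new edge has [y] as an endpoint, so a step avoiding [y] belongs to [e]. *)
have eE z w : z != y -> w != y -> add_edge e u v z w -> e z w.
  move=> zy wy /or3P[//| |] /andP[/eqP zE /eqP wE]; subst z w;
  by case/orP: uvE => /andP[_ /eqP yE]; subst y; rewrite eqxx in zy wy.
have {}eya : e y a.
  move: xs'; rewrite !inE !negb_or => /and3P[xy xa _].
  case/or3P: eya => // /andP[/eqP yE /eqP aE]; subst y a;
  by case/orP: uvE => /andP[/eqP xE /eqP yE]; subst; rewrite ?eqxx in xy xa.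
have py : path e y (rcons (a :: q) x).
  rewrite /= eya /=.
  have : all [pred z | z != y] (a :: rcons q x).
    apply/allP=> z; rewrite /= inE mem_rcons inE.
    move: ys' xs'; rewrite !inE !negb_or => /andP[ya yq] /and3P[xy _ _].
    by case/or3P=> [/eqP->|/eqP->|zq] //; [rewrite eq_sym|apply: contraNneq yq => <-].
  by move/(sub_in_path eE); apply.
(* Either of [x] and [y] may be [u], so both memberships are derived. *)
have yx : x \in ball e g y.
  have := path_ball (l := g) py; rewrite last_rcons size_rcons; apply.
  by rewrite ltnW // ltnW.
have xy : y \in ball e g x.
  have := py; rewrite -rev_path last_rcons belast_rcons.
  rewrite (eq_path (e' := e)) => [pr|z w]; last exact: se.
  have := path_ball (l := g) pr; rewrite rev_cons last_rcons size_rcons size_rev.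
  by apply; rewrite ltnW // ltnW.
by case/orP: uvE => /andP[/eqP xE /eqP yE]; subst; rewrite ?xy ?yx in vu.
Qed.

Definition indep_sets e s : {set {set T}} :=
  [set S : {set T} | (s <= #|S|) && [forall x in S, forall y in S, ~~ e x y]].

(** The sets that survive the new edge are old ones missing [u] or [v], so they are disjoint from
    the second family. *)
Lemma card_indep_add_edge e u v s :
  #|indep_sets (add_edge e u v) s|
    + #|[set S in indep_sets e s | (u \in S) && (v \in S)]|
  <= #|indep_sets e s|.
Proof.
rewrite -[leqRHS](cardsID [set S : {set T} | (u \in S) && (v \in S)]) addnC.
apply: leq_add; apply: subset_leq_card; apply/subsetP=> S; rewrite !inE //.
case/andP=> -> iS /=; apply/andP; split.
  apply/negP=> /andP[uS vS].
  by have /forall_inP/(_ _ uS)/forall_inP/(_ _ vS) := iS; rewrite /add_edge !eqxx orbT.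
apply/forall_inP=> x xS; apply/forall_inP=> y yS.
by have /forall_inP/(_ _ xS)/forall_inP/(_ _ yS) := iS; rewrite negb_or => /andP[].
Qed.

(** * Counting addable pairs *)

(** Markov's inequality for degrees. *)
Lemma card_full e D m :
  \sum_x deg e x <= D * m -> 0 < D -> #|[set x | D <= deg e x]| <= m.
Proof.
move=> h D0; rewrite -(leq_pmul2l D0); apply: leq_trans h.
rewrite mulnC -sum_nat_const big_mkcond leq_sum // => x _.
by rewrite inE; case: ifP.
Qed.

Definition addable e g D : {set T * T} :=
  [set w | [&& deg e w.1 < D, deg e w.2 < D & w.2 \notin ball e g w.1]].

(** By [card_full] at least [t] vertices of [S] have degree below [D], and at most [D.+1 ^ g] of
    them lie in the ball around any given one. *)
Lemma card_addable e g D t S :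
  (forall x, deg e x <= D) -> 0 < D -> \sum_x deg e x <= D * t ->
  t + t <= #|S| ->
  t * (t - D.+1 ^ g) <= #|addable e g D :&: setX S S|.
Proof.
move=> degD D0 sD tS; pose A := [set x in S | deg e x < D].
have tA : t <= #|A|.
  have := card_full sD D0; have := cardsID [set x | D <= deg e x] S.
  have -> : S :\: [set x | D <= deg e x] = A.
    by apply/setP=> x; rewrite !inE -ltnNge andbC.
  have := subset_leq_card (subsetIr S [set x | D <= deg e x]).
  lia.
apply: leq_trans (_ : #|[set w in setX A A | w.2 \notin ball e g w.1]| <= _).
  rewrite -sum1_card.
  rewrite (eq_bigl (fun w => (w.1 \in A) && (w.2 \in A :\: ball e g w.1))); last first.
    by move=> w; rewrite !inE; case: (_ \in ball _ _ _); rewrite ?andbT ?andbF.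
  rewrite -(pair_big_dep (mem A) (fun x y => y \in A :\: ball e g x) (fun _ _ => 1)) /=.
  apply: leq_trans (_ : _ <= \sum_(x in A) (t - D.+1 ^ g)) _.
    by rewrite sum_nat_const leq_mul2r tA orbT.
  apply: leq_sum => x _; rewrite sum1_card cardsD.
  have := card_ball g x degD; have := subset_leq_card (subsetIr A (ball e g x)).
  lia.
apply: subset_leq_card; apply/subsetP=> [[x y]]; rewrite !inE /=.
by case/andP=> /andP[/andP[-> ->] /andP[-> ->]] ->.
Qed.

(* Each independent set contains at least 1/c of all pairs as addable pairs,
   so by double counting some addable pair destroys 1/c of the sets. *)
Lemma exists_addable e g D s c :
  (forall S, S \in indep_sets e s ->
     #|T| ^ 2 <= c * #|addable e g D :&: setX S S|) ->
  0 < #|indep_sets e s| -> 0 < #|T| ->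
  exists2 w, w \in addable e g D &
    #|indep_sets e s|
    <= c * #|[set S in indep_sets e s | (w.1 \in S) && (w.2 \in S)]|.
Proof.
move=> hS I0 T0; set I := indep_sets e s; set P := addable e g D.
apply/exists_inP; apply: contraT => /exists_inPn nP.
have P0 : 0 < #|P|.
  have /card_gt0P[S SI] := I0; have := hS S SI.
  have := subset_leq_card (subsetIl (addable e g D) (setX S S)).
  rewrite -/P; case: #|P| => //; rewrite leqn0 => /eqP->.
  by rewrite muln0 leqn0 expn_eq0 -leqn0 leqNgt T0.
have : #|I| * #|T| ^ 2 < #|I| * #|P|.
  rewrite -sum_nat_const.
  apply: leq_ltn_trans (_ : _ <= \sum_(S in I) c * #|P :&: setX S S|) _.
    by apply: leq_sum => S SI; apply: hS.
  rewrite -big_distrr /=.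
  have -> : \sum_(S in I) #|P :&: setX S S|
     = \sum_(w in P) #|[set S in I | (w.1 \in S) && (w.2 \in S)]|.
    under eq_bigr do rewrite -sum1_card.
    rewrite (exchange_big_dep (mem P)) /=; last by move=> S w _ /setIP[].
    apply: eq_bigr => -[x y] wP; rewrite -sum1_card; apply: eq_bigl => S.
    by rewrite in_setI wP in_setX inE.
  rewrite big_distrr /= mulnC -sum_nat_const.
  (* One pair is split off to keep the inequality strict. *)
  have [w0 w0P] := card_gt0P P0.
  rewrite (bigD1 w0) //= [X in _ < X](bigD1 w0) //= -addSn leq_add //.
    by rewrite ltnNge; apply: nP.
  by apply: leq_sum => w /andP[wP _]; rewrite ltnW // ltnNge; apply: nP.
rewrite ltn_pmul2l // ltnNge; case/negP.
by apply: leq_trans (max_card _) _; rewrite card_prod mulnn.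
Qed.

End Greedy.

(** * Decay of the number of large independent sets *)

(** Bernoulli's inequality for [1 + 1/d], cleared of denominators. *)
Lemma bernoulli d m : d ^ m.+1 + m.+1 * d ^ m <= d.+1 ^ m.+1.
Proof.
elim: m => [|m IHm]; first by rewrite !expn1 expn0; lia.
rewrite [leqRHS]expnS; apply: leq_trans (leq_mul (leqnn d.+1) IHm).
rewrite !expnS; set p := d ^ m; nia.
Qed.

(** Multiplying [d.+1] times by [d / d.+1] more than halves a positive quantity. *)
Lemma double_expn_lt d : 0 < d -> 2 * d ^ d.+1 < d.+1 ^ d.+1.
Proof.
move=> d0; apply: leq_trans (bernoulli d d).
by rewrite !expnS; have : 0 < d ^ d; [rewrite expn_gt0 d0 | nia].
Qed.

(* An independent set has size >= 4b = 2t.  At most d.+1 * #|T| edges are ever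
   added, so D is large enough for at most t = 2b vertices to be saturated;
   since balls have size at most b, every such set then contains at least
   t * (t - b) = 2b^2 = #|T|^2 / d.+1 addable pairs. *)
Section Process.
Variables (T : finType) (g k : nat).
Hypothesis k0 : 0 < k.
Let d := (8 * k ^ 2).-1.
Let D := 4 * d.+1 * k.
Let b := D.+1 ^ g.
Hypothesis cardT : #|T| = 4 * k * b.

Lemma greedy_process i : i <= d.+1 * #|T| ->
  exists e : rel T, [/\ symmetric e, irreflexive e, cycles_ge e g &
    [/\ forall x, deg e x <= D, \sum_x deg e x <= 2 * i &
        #|indep_sets e (4 * b)| * d.+1 ^ i <= 2 ^ #|T| * d ^ i]].
Proof.
have dE : d.+1 = 8 * k ^ 2 by rewrite /d prednK // muln_gt0 expn_gt0 k0.
have b0 : 0 < b by rewrite expn_gt0.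
elim: i => [_|i IHi lti].
  exists (fun _ _ => false); split=> //.
    by move=> [//|x [//|y s]] _ /andP[] /=.
  have deg0 x : deg (fun _ _ : T => false) x = 0.
    by apply: eq_card0 => y; rewrite inE.
  split=> [x||]; rewrite ?deg0 //.
    by rewrite big1 // => x _.
  rewrite !expn0 !muln1 -cardsT -card_powerset; apply: subset_leq_card.
  by apply/subsetP=> S _; rewrite powersetE subsetT.
have [e [se ie ge [De sumD eN]]] := IHi (ltnW lti).
(* Once no large independent set remains, the graph is kept as it is. *)
have [N0|N0] := posnP #|indep_sets e (4 * b)|.
  by exists e; split=> //; split=> //; [lia|rewrite N0].
have T0 : 0 < #|T| by rewrite cardT !muln_gt0 k0 b0.
have D0 : 0 < D by rewrite !muln_gt0 k0.
have [S|[u v] /=] := @exists_addable _ e g D (4 * b) d.+1 _ N0 T0.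
  rewrite inE => /andP[sS _].
  have sum_le : \sum_x deg e x <= D * (2 * b).
    apply: leq_trans sumD _; rewrite /D.
    apply: leq_trans (_ : 2 * (d.+1 * #|T|) <= _); first by rewrite leq_mul2l ltnW.
    rewrite cardT; nia.
  have := card_addable g De D0 sum_le.
  move/(_ S); rewrite -mulnDl => /(_ sS); rewrite -/b => h.
  apply: leq_trans (leq_mul (leqnn d.+1) h).
  rewrite cardT dE; have -> : 2 * b - b = b by lia.
  by nia.
rewrite inE /= => /and3P[du dv vu] kill.
have uv : u != v.
  apply: contraNneq vu => <-.
  exact: (@path_ball _ e g u [::]).
exists (add_edge e u v); split.
- exact: add_edge_sym.
- exact: add_edge_irr.
- exact: cycles_ge_add_edge.
split.
- move=> x; apply: leq_trans (deg_add_edge e u v x) _.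
  have := De x; case: (eqVneq x u) => [->|_]; last case: (eqVneq x v) => [->|_].
  + rewrite (negbTE uv); lia.
  + lia.
  + lia.
- by apply: leq_trans (sum_deg_add_edge e u v) _; lia.
have := card_indep_add_edge e u v (4 * b).
move: kill eN; set N := #|indep_sets e _|; set N' := #|indep_sets (add_edge _ _ _) _|.
set K := #|[set _ in _ | _]| => kill eN NK.
(* The chosen pair kills [K >= N / d.+1] of the [N] sets. *)
have N'd : N' * d.+1 <= N * d by nia.
rewrite !expnS mulnA; apply: leq_trans (leq_mul N'd (leqnn _)) _.
by rewrite mulnAC [leqRHS]mulnCA [leqLHS]mulnC leq_mul2l eN orbT.
Qed.

(** After [d.+1 * #|T|] steps the initial bound [2 ^ #|T|] has been more than halved [#|T|] times,
    so fewer than one set is left. *)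
Lemma greedy_no_indep : exists e : rel T,
  [/\ symmetric e, irreflexive e, cycles_ge e g & indep_sets e (4 * b) = set0].
Proof.
have [e [se ie ge [_ _ eN]]] := greedy_process (leqnn _).
exists e; split=> //; apply/eqP; rewrite -cards_eq0.
have dE : d.+1 = 8 * k ^ 2 by rewrite /d prednK // muln_gt0 expn_gt0 k0.
have d0 : 0 < d by have : 0 < k ^ 2; [rewrite expn_gt0 k0 | lia].
have T0 : 0 < #|T| by rewrite cardT !muln_gt0 k0 expn_gt0.
apply: contraTT eN; rewrite -lt0n -ltnNge => N0.
rewrite !expnM -expnMn; apply: leq_trans (_ : (d.+1 ^ d.+1) ^ #|T| <= _).
  by rewrite ltn_exp2r // double_expn_lt.
by rewrite leq_pmull.
Qed.

End Process.

(** The classes of a proper colouring are independent, hence have at most [4 * b] vertices, and [k]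
    of them cannot cover [4 * k.+1 * b] vertices. *)
Lemma large_girth_and_chromatic_number g k : exists n, exists e : rel 'I_n,
  [/\ symmetric e, irreflexive e, cycles_ge e g &
      forall (C : finType) (c : 'I_n -> C), #|C| <= k ->
        exists x y, e x y /\ c x = c y].
Proof.
pose b := (4 * (8 * k.+1 ^ 2).-1.+1 * k.+1).+1 ^ g.
exists (4 * k.+1 * b).
have [e [se ie ge e0]] := @greedy_no_indep 'I_(4 * k.+1 * b) g k.+1 isT (card_ord _).
exists e; split=> // C c Ck.
have [/existsP[x /existsP[y /andP[exy /eqP cxy]]]|/existsPn nex] :=
  boolP [exists x, exists y, e x y && (c x == c y)]; first by exists x, y.
have small a : #|[set x | c x == a]| <= 4 * b.
  rewrite leqNgt; apply/negP=> /ltnW big.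
  have : [set x | c x == a] \in indep_sets e (4 * b).
    rewrite inE big /=; apply/forall_inP=> x; rewrite inE => /eqP xa.
    apply/forall_inP=> y; rewrite inE => /eqP ya.
    by have /existsPn/(_ y) := nex x; rewrite xa ya eqxx andbT.
  by rewrite e0 inE.
have : 4 * k.+1 * b <= k * (4 * b).
  rewrite -[leqLHS]card_ord -sum1_card (partition_big c xpredT) //=.
  apply: leq_trans (_ : \sum_(a : C) 4 * b <= _).
    apply: leq_sum => a _; rewrite sum1_card; apply: leq_trans (small a).
    by rewrite leq_eqVlt; apply/orP; left; apply/eqP; apply: eq_card => x; rewrite !inE.
  by rewrite sum_nat_const leq_mul2r Ck orbT.
by have : 0 < b; [rewrite expn_gt0 | nia].
Qed.

(** * Comparability graphs and shift graphs *)

Section GraphOf.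
Variables (T : finType) (A : {set T}) (r : rel T).

Fact graph_of_subproof :
  [set [set x; y] | x in A, y in A & (x != y) && r x y]
    \subset [set e : {set T} | (e \subset A) && (#|e| == 2)].
Proof.
apply/subsetP=> e /imset2P[x y xA]; rewrite inE => /and3P[yA xy _] ->.
by rewrite inE subUset !sub1set xA yA cards2 xy.
Qed.

Definition graph_of := Graph graph_of_subproof.

Lemma adj_graph_of x y :
  adj graph_of x y = [&& x \in A, y \in A, x != y & r x y || r y x].
Proof.
apply/imset2P/and4P=> [[a b aA]|[xA yA xy /orP[rxy|ryx]]].
- rewrite inE => /and3P[bA ab rab] xyE.
  have xy : x != y.
    by have := cards2 x y; rewrite xyE cards2 ab; case: (x != y).
  have : x \in [set a; b] by rewrite -xyE set21.
  have : y \in [set a; b] by rewrite -xyE set22.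
  rewrite !inE => /orP[]/eqP yE /orP[]/eqP xE; subst x y;
  by rewrite ?eqxx // in xy *; rewrite ?aA ?bA ?ab ?rab ?orbT // eq_sym.
- by exists x y; rewrite // inE yA xy.
- by exists y x; rewrite ?inE ?xA ?[y == x]eq_sym ?xy // setUC.
Qed.

End GraphOf.

Definition comparability_graphs : graph_family := fun T K =>
  exists lt : rel (vertex K), [/\ irreflexive lt, transitive lt &
    forall x y, adj K (val x) (val y) = lt x y || lt y x].

(** The order is pulled back along [h]; this serves isomorphic copies and induced subgraphs
    alike. *)
Lemma comparability_graphs_embed (T U : finType) (G : graph T) (H : graph U)
    (h : vertex H -> vertex G) :
  (forall x y, adj G (val (h x)) (val (h y)) = adj H (val x) (val y)) ->
  comparability_graphs G -> comparability_graphs H.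
Proof.
move=> hE [lt [irr tr ltE]]; exists (fun x y => lt (h x) (h y)); split=> //.
- by move=> y x z /=; apply: tr.
- by move=> x y; rewrite -hE ltE.
Qed.

Lemma comparability_graphs_class : graph_class comparability_graphs.
Proof.
split=> [T U G H [f [h fK hK] fE]|T G S].
  by apply: (@comparability_graphs_embed _ _ _ _ h) => x y; rewrite -fE !hK.
have sub (x : vertex (induced G S)) : val x \in vset G.
  by have /setIP[] := valP x.
have subS (x : vertex (induced G S)) : val x \in S.
  by have /setIP[] := valP x.
apply: (@comparability_graphs_embed _ _ _ _ (fun x => Sub (val x) (sub x))).
by move=> x y; rewrite adj_induced.
Qed.

(** * Mirsky's theorem: colouring a comparability graph by heights *)

Section Mirsky.
Variables (T : finType) (K : graph T) (lt : rel (vertex K)).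
Hypotheses (irr : irreflexive lt) (tr : transitive lt).
Hypothesis ltE : forall x y, adj K (val x) (val y) = lt x y || lt y x.

(** Chains of [lt] are encoded as cliques of [K], so that heights compare directly with [omega]. *)
Definition chain_below (x : vertex K) (S : {set vertex K}) : bool :=
  clique K (val @: S) && [forall y in S, lt y x].

Definition height x := \max_(S : {set vertex K} | chain_below x S) #|S|.

Lemma chain_below_add x S :
  chain_below x S -> clique K (val @: (x |: S)) /\ #|x |: S| = #|S|.+1.
Proof.
move=> /andP[/andP[sS /forall_inP cS] /forall_inP ltS]; split; last first.
  by rewrite cardsU1; case: (boolP (x \in S)) => // /ltS; rewrite irr.
apply/andP; split; first by apply/subsetP=> _ /imsetP[y _ ->]; apply: valP.
apply/forall_inP=> _ /imsetP[y yS ->]; apply/forall_inP=> _ /imsetP[z zS ->].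
apply/implyP; move: yS zS => /setU1P[->|yS] /setU1P[->|zS]; rewrite ?eqxx //.
- by rewrite ltE ltS ?orbT.
- by rewrite ltE ltS.
- by apply/implyP; apply: (forall_inP (cS _ (imset_f _ yS))); apply: imset_f.
Qed.

Lemma height_ex x : exists2 S, chain_below x S & height x = #|S|.
Proof.
have h0 : chain_below x set0.
  rewrite /chain_below /clique imset0 sub0set; apply/andP; split.
    by apply/forall_inP=> y; rewrite inE.
  by apply/forall_inP=> y; rewrite inE.
by exists [arg max_(S > set0 | chain_below x S) #|S|];
   [case: arg_maxnP | rewrite /height (bigmax_eq_arg set0)].
Qed.

(** A longest chain below [x] together with [x] is a clique. *)
Lemma height_omega x : height x < omega K.
Proof.
have [S cS ->] := height_ex x; have [cx <-] := chain_below_add cS.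
rewrite -(card_imset _ val_inj).
exact: (@leq_bigmax_cond _ (clique K) (fun S : {set T} => #|S|) _ cx).
Qed.

(** A longest chain below [x], extended by [x], lies below [y]. *)
Lemma height_lt x y : lt x y -> height x < height y.
Proof.
move=> xy; have [S cS ->] := height_ex x; have [cx <-] := chain_below_add cS.
apply: (@leq_bigmax_cond _ (chain_below y) (fun S : {set _} => #|S|)).
rewrite /chain_below cx /=; apply/forall_inP=> z /setU1P[->//|zS].
by case/andP: cS => _ /forall_inP/(_ z zS) zx; apply: tr zx xy.
Qed.

Lemma comparability_colorable : colorable K (omega K).
Proof.
apply/existsP; exists [ffun x => Ordinal (height_omega x)].
apply/forallP=> x; apply/forallP=> y; apply/implyP; rewrite ltE !ffunE.
by case/orP=> /height_lt; rewrite -(inj_eq val_inj) /=; apply: contraTneq => ->;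
  rewrite ltnn.
Qed.

End Mirsky.

Lemma comparability_chi_bounded : chi_bounded comparability_graphs.
Proof.
exists id => // T G [lt [irr tr ltE]]; rewrite /chi; case: ex_minnP => m _.
by apply; apply: comparability_colorable ltE.
Qed.

(** * Shift graphs as intersections of line graphs with interval orders *)

Section Shift.
Variables (n : nat) (e : rel 'I_n).
Hypotheses (se : symmetric e) (ie : irreflexive e).

Definition base_graph := graph_of setT e.

Lemma adj_base : adj base_graph =2 e.
Proof.
move=> x y; rewrite adj_graph_of !inE /= [e y x]se orbb.
by case: eqVneq => // ->; rewrite ie.
Qed.

(* max a <= min b: the edges, viewed as intervals, form an interval order. *)
Definition before (a b : {set 'I_n}) :=
  [forall x in a, forall y in b, x <= y].

(** It shares its ambient type and vertex set with the line graph of [base_graph], so the two can be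
    intersected literally. *)
Definition interval_graph := graph_of (eset base_graph) before.

Lemma edgeP (a : {set 'I_n}) : a \in eset base_graph ->
  exists x y : 'I_n, [/\ x < y, a = [set x; y] & e x y].
Proof.
case/imset2P=> x y _; rewrite inE => /and3P[_ xy exy] ->.
have [lt_xy|lt_yx|/val_inj E] := ltngtP x y.
- by exists x, y.
- by exists y, x; rewrite setUC se.
- by rewrite E eqxx in xy.
Qed.

Lemma beforeP (a b : {set 'I_n}) :
  reflect (forall x y, x \in a -> y \in b -> x <= y) (before a b).
Proof.
apply: (iffP forall_inP) => [h x y xa yb|h x xa].
  exact: (forall_inP (h x xa)).
by apply/forall_inP=> y; apply: h.
Qed.

Lemma before_irr a : a \in eset base_graph -> before a a = false.
Proof.
case/edgeP=> x [y [xy -> _]]; apply/negP=> /beforeP/(_ y x).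
by rewrite set21 set22 leqNgt xy => /(_ isT isT).
Qed.

Lemma before_trans a b c :
  b \in eset base_graph -> before a b -> before b c -> before a c.
Proof.
case/edgeP=> x [y [xy -> _]] /beforeP ab /beforeP bc.
by apply/beforeP=> z t za tc; apply: leq_trans (ab z x _ _) (bc x t _ _);
  rewrite ?set21.
Qed.

(** All of [a] is at most the lower end of [b], and all of [c] at least its upper end. *)
Lemma before_disjoint a b c :
  b \in eset base_graph -> before a b -> before b c -> a :&: c = set0.
Proof.
case/edgeP=> x [y [xy -> _]] /beforeP ab /beforeP bc.
apply/eqP; rewrite -subset0; apply/subsetP=> z /setIP[za zc].
have := ab z x za (set21 _ _); have := bc y z (set22 _ _) zc.
by move=> yz zx; rewrite ltnNge (leq_trans yz zx) in xy.
Qed.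

Lemma interval_comparability : comparability_graphs interval_graph.
Proof.
exists (fun a b => before (val a) (val b)); split.
- by move=> a; apply: before_irr (valP a).
- by move=> b a c; apply: before_trans (valP b).
- move=> a b; rewrite adj_graph_of (valP a) (valP b) /=.
  case: eqVneq => // ->; by rewrite (before_irr (valP b)).
Qed.

Definition shift_graph := graph_inter (line_graph base_graph) interval_graph.

Lemma adj_shift a b : adj shift_graph a b =
  [&& a \in eset base_graph, b \in eset base_graph,
      a :&: b != set0 & before a b || before b a].
Proof.
transitivity (adj (line_graph base_graph) a b && adj interval_graph a b).
  by rewrite /adj inE.
rewrite adj_line_graph adj_graph_of.
case: (boolP (a \in _)) => //= aE; case: (boolP (b \in _)) => //= bE.
case: eqVneq => //= ab; rewrite ab before_irr // andbF //.
Qed.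

(** Of three pairwise comparable edges one lies between the other two, which are then disjoint and
    so not adjacent in the line graph. *)
Lemma omega_shift : omega shift_graph <= 2.
Proof.
apply/bigmax_leqP=> S /andP[_ /forall_inP cS]; rewrite leqNgt.
apply/negP=> /card_gt2P[a [b [c [[aS bS cS'] [ab bc ca]]]]].
have adjS x y : x \in S -> y \in S -> x != y -> adj shift_graph x y.
  by move=> xS yS; apply/implyP; apply: (forall_inP (cS x xS)).
have := adjS a b aS bS ab; have := adjS b c bS cS' bc.
have := adjS c a cS' aS ca; rewrite !adj_shift.
case/and4P=> cE aE ica oca /and4P[bE _ ibc obc] /and4P[_ _ iab oab].
have D x y z : y \in eset base_graph -> before x y -> before y z ->
  (x :&: z != set0) || (z :&: x != set0) -> False.
  by move=> yE xy yz; rewrite (setIC z x) orbb (before_disjoint yE xy yz) eqxx.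
(* Every orientation of the three pairs, the cyclic ones included, contains a directed path on all
   three edges. *)
case/orP: oca => oca; case/orP: obc => obc; case/orP: oab => oab;
 first [ by apply: (D a b c) => //; rewrite ?ica ?orbT
       | by apply: (D c b a) => //; rewrite ?ica ?orbT
       | by apply: (D b c a) => //; rewrite ?iab ?orbT
       | by apply: (D a c b) => //; rewrite ?iab ?orbT
       | by apply: (D b a c) => //; rewrite ?ibc ?orbT
       | by apply: (D c a b) => //; rewrite ?ibc ?orbT ].
Qed.

(* Colour a vertex x by the set of colours of the edges {x < y}: if the edge
   {x < y} had a colour c also used by some edge {y < z}, these two adjacent
   vertices of the shift graph would share c. *)
Lemma colorable_shift q : colorable shift_graph q ->
  exists c : 'I_n -> {set 'I_q}, forall x y, e x y -> c x != c y.
Proof.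
move=> /existsP[c /forallP cP].
pose col (x : 'I_n) := [set c a | a : vertex shift_graph &
  [exists y : 'I_n, (x < y) && (val a == [set x; y])]].
have main (x y : 'I_n) : x < y -> e x y -> col x != col y.
  move=> xy exy; have aE : [set x; y] \in vset shift_graph.
    by rewrite inE /= andbb; have := adj_base x y; rewrite exy.
  apply/eqP=> E; have : c (Sub [set x; y] aE) \in col y.
    by rewrite -E; apply: imset_f; rewrite inE; apply/existsP; exists y; rewrite xy /=.
  case/imsetP=> b; rewrite inE => /existsP[z /andP[yz /eqP bE]] /eqP.
  apply/negP/(implyP (forallP (cP _) _)).
  have /setIP[bG _] := valP b; have /setIP[aG _] := aE.
  rewrite adj_shift bG bE aG -bE /= bE; apply/andP; split.
    by apply/set0Pn; exists y; rewrite !inE eqxx orbT.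
  apply/orP; left; apply/beforeP=> t w; rewrite !inE.
  by do 2!case/orP=> /eqP->; rewrite ?leqnn //; lia.
exists col => x y exy; have [lt_xy|lt_yx|/val_inj E] := ltngtP x y.
- exact: main.
- by rewrite eq_sym main // se.
- by rewrite E ie in exy.
Qed.

End Shift.

(** * Failure of the guarding property *)

Lemma isomorphic_refl (T : finType) (G : graph T) : isomorphic G G.
Proof. by exists id => //; exists id. Qed.

Lemma line_graphs_girth_not_guarding g :
  ~ intersectionwise_chi_guarding (line_graphs_girth g).
Proof.
move=> /(_ _ comparability_graphs_class comparability_chi_bounded)[f fmono fP].
(* The shift graph has clique number at most 2, so [f] would give it [f 2] colours, and these yield
   [2 ^ f 2] colours for [e]. *)
have [n [e [se ie ge nc]]] := large_girth_and_chromatic_number g (2 ^ f 2).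
have {fP}chi_le : chi (shift_graph e) <= f (omega (shift_graph e)).
  apply: fP.
  exists {set 'I_n}, (line_graph (base_graph e)), (interval_graph e); split.
  - exists 'I_n, (base_graph e); split; last exact: isomorphic_refl.
    apply/girth_at_leastP=> s /andP[s2 /andP[cs us]]; apply: ge => //.
    by rewrite /ucycleb us -(eq_cycle (adj_base se ie)) cs.
  - exact: interval_comparability.
  - exact: isomorphic_refl.
have {}chi_le := leq_trans chi_le (fmono _ _ (omega_shift se)).
have : colorable (shift_graph e) (chi (shift_graph e)).
  by rewrite /chi; case: ex_minnP.
case/(colorable_shift se ie)=> c cP.
have [|x [y [exy /eqP]]] := nc _ c; last by apply/negP/cP.
by rewrite -cardsT -powersetT card_powerset cardsT card_ord leq_exp2l.
Qed.

Lemma intersectionwise_chi_guarding_sub (A B : graph_family) :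
  (forall T K, A T K -> B T K) ->
  intersectionwise_chi_guarding B -> intersectionwise_chi_guarding A.
Proof.
move=> AB gB D Dcl Dchi; have [f fm fP] := gB D Dcl Dchi; exists f => // T K.
case=> U [G [H [AG DH GH]]]; apply: fP; exists U, G, H; split=> //.
exact: AB.
Qed.

Theorem theorem4p3 :
  (forall g : nat, 3 <= g ->
     ~ intersectionwise_chi_guarding (line_graphs_girth g)) /\
  ~ intersectionwise_chi_guarding line_graphs.
Proof.
split=> [g _|gL]; first exact: line_graphs_girth_not_guarding.
apply: (@line_graphs_girth_not_guarding 3).
by apply: intersectionwise_chi_guarding_sub gL => T K [U [G [_ GK]]]; exists U, G.
Qed.
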